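(* Let $\mathcal{L}$ and $\mathcal{K}$ be finite meet-semilattices and let $\mathcal{L}\hookrightarrow\mathcal{K}$ be a consistent meet-semilattice order embedding (identify $\mathcal{L}$ with its image, so $\mathcal{L}$ and $\mathcal{K}$ share the minimum $\hat 0$). Then (1) $\mathbb{B}(\mathcal{L})=\{B\cap\mathcal{L}^+ : B\in\mathbb{B}(\mathcal{K}),\ I(\mathcal{L})\subseteq B\}$; (2) if $B\in\mathbb{B}(\mathcal{K})$ and $I(\mathcal{L})\subseteq B$, then $\mathcal{N}_{\mathcal{L}}(B\cap\mathcal{L}^+)\subseteq\mathcal{N}_{\mathcal{K}}(B)$.
   Context: All posets are finite. For a meet-semilattice $\mathcal{P}$ with minimum $\hat 0$, $\mathcal{P}^+=\mathcal{P}\setminus\{\hat 0\}$; $[x,y]=\{z:x\le z\le y\}$. A poset is irreducible if it is not isomorphic to a product of two posets each with at least two elements; $I(\mathcal{P})=\{x\in\mathcal{P}^+: [\hat 0,x]\text{ irreducible}\}$. For $B\subseteq\mathcal{P}$, $B_{\le x}=\{z\in B:z\le x\}$, and $\max B_{\le x}$ is its set of maximal elements. A building set of $\mathcal{P}$ is $B\subseteq\mathcal{P}^+$ such that for every $x\in\mathcal{P}^+$ with $\max B_{\le x}=\{x_1,\dots,x_k\}$, the map $\prod_{j}[\hat 0,x_j]\to[\hat 0,x]$, $(y_j)\mapsto y_1\vee\cdots\vee y_k$, is a poset isomorphism (joins computed in $\mathcal{P}$); $\mathbb{B}(\mathcal{P})$ denotes the set of building sets. For $B\in\mathbb{B}(\mathcal{P})$,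 a subset $N\subseteq B$ is nested if for every collection $x_1,\dots,x_t\in N$ with $t\ge 2$ of pairwise incomparable elements, the join $\bigvee_{i=1}^t x_i$ exists in $\mathcal{P}$ and does not belong to $B$; $\mathcal{N}_{\mathcal{P}}(B)$ is the simplicial complex of all nested sets of $B$ (joins taken in $\mathcal{P}$). A meet-semilattice order embedding $f:\mathcal{L}\to\mathcal{K}$ is a map with $x\le y\iff f(x)\le f(y)$ and $f(x\wedge^{\mathcal{L}}y)=f(x)\wedge^{\mathcal{K}}f(y)$ for all $x,y$ (it need not preserve joins). It is consistent if for every $x\in\mathcal{L}^+$, $I(\mathcal{K})_{\le_{\mathcal{K}}x}\subseteq I(\mathcal{L})_{\le_{\mathcal{L}}x}$. *)

(* Defs.v *)
From HB Require Import structures.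
From mathcomp Require Import all_boot all_order.
From mathcomp Require Import boolp.

Set Implicit Arguments.
Unset Strict Implicit.
Unset Printing Implicit Defensive.

Import Order.TTheory.
Local Open Scope order_scope.

(* The interval [x, y] as a poset in its own right, ordered as in P. *)
Record poset_itv d (P : finPOrderType d) (x y : P) : Type :=
  PosetItv { itv_val : P; _ : x <= itv_val <= y }.
HB.instance Definition _ d (P : finPOrderType d) (x y : P) :=
  [isSub for @itv_val d P x y].
HB.instance Definition _ d (P : finPOrderType d) (x y : P) :=
  [Finite of poset_itv x y by <:].
HB.instance Definition _ d (P : finPOrderType d) (x y : P) :=
  [SubChoice_isSubPOrder of poset_itv x y by <: with d].

Definition order_iso (S T : Type) (leS : rel S) (leT : rel T) (f : S -> T) :=
  bijective f /\ {mono f : x y / leS x y >-> leT x y}.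

(* Q1 *p Q2 is the cartesian product with the componentwise order. *)
Definition irreducible_poset d (P : finPOrderType d) : Prop :=
  ~ exists (d1 d2 : Order.disp_t)
      (Q1 : finPOrderType d1) (Q2 : finPOrderType d2) (f : P -> Q1 *p Q2),
      [/\ (1 < #|Q1|)%N, (1 < #|Q2|)%N & order_iso <=%O <=%O f].

(* Finite joins in P are partial, hence given by a relation. *)
Definition is_join d (P : porderType d) (A : {pred P}) (z : P) : Prop :=
  {in A, forall a, a <= z} /\ (forall u, {in A, forall a, a <= u} -> z <= u).

Section MeetSemilattice.
Variables (d : Order.disp_t) (P : finBMeetSemilatticeType d).
Implicit Types (x : P) (A B N : {set P}).

Definition pos_elts : {set P} := [set x | x != \bot].

Definition irreducibles : {set P} :=
  [set x in pos_elts | `[< irreducible_poset (poset_itv \bot x) >]].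

Definition below B x : {set P} := [set z in B | z <= x].

Definition max_below B x : {set P} :=
  [set z in below B x | [forall w in below B x, (z <= w) ==> (w == z)]].

(* The product of the posets [0, b] for b in A: choice functions with the
   pointwise order. *)
Definition itv_prod A : Type :=
  {dffun forall b : {b : P | b \in A}, poset_itv \bot (val b)}.

Definition itv_prod_le A : rel (itv_prod A) :=
  fun y y' => [forall b, y b <= y' b].

Definition is_join_map A x (phi : itv_prod A -> poset_itv \bot x) : Prop :=
  forall y : itv_prod A,
    is_join [set val (y b) | b : {b : P | b \in A}] (val (phi y)).

Definition building_set B : Prop :=
  B \subset pos_elts /\
  forall x, x \in pos_elts ->
    exists phi : itv_prod (max_below B x) -> poset_itv \bot x,
      is_join_map phi /\ order_iso (@itv_prod_le (max_below B x)) <=%O phi.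

Definition building_sets : {set {set P}} := [set B | `[< building_set B >]].

Definition nested_set B N : Prop :=
  N \subset B /\
  forall A, A \subset N -> (2 <= #|A|)%N ->
    {in A &, forall a b, a != b -> a >< b} ->
    exists2 z, is_join A z & z \notin B.

Definition nested_complex B : {set {set P}} := [set N | `[< nested_set B N >]].

End MeetSemilattice.

Arguments pos_elts {d} P.
Arguments irreducibles {d} P.
Arguments building_sets {d} P.

Section Embedding.
Variables (dL dK : Order.disp_t).
Variables (L : finBMeetSemilatticeType dL) (K : finBMeetSemilatticeType dK).
Variable f : L -> K.

Definition meet_embedding : Prop :=
  {mono f : x y / x <= y} /\ {morph f : x y / x `&` y}.

(* As L is identified with its image, subsets of L are compared with subsets
   of K through direct images under f. *)
Definition consistent : Prop :=
  forall x, x \in pos_elts L ->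
    below (irreducibles K) (f x) \subset f @: below (irreducibles L) x.

(* The intersection of B with the positive part of L, seen as a subset of L. *)
Definition trace (B : {set K}) : {set L} := pos_elts L :&: f @^-1: B.

End Embedding.

(* Main.v *)
(* A set A of elements below x "decomposes" x when [0, x] is the product of the
   [0, u] for u in A, via z |-> (z /\ u)_u.  Decompositions can be refined,
   restricted to a smaller z and coarsened, and an irreducible m below x lies
   below some member of any decomposition of x.  A set B of positive elements
   is building as soon as every x outside B has a decomposition, not containing
   x, such that every element of B below x lies below one of its members.

   By consistency, the irreducibles of K below f l come from irreducibles of L
   below l.  Hence a decomposition of l in L is one of f l in K, and, when the
   building set B of K contains f(I(L)), the B-factors of f l (for f l not in B)
   induce a decomposition of l in L that separates the elements of B in the same
   way.  The latter gives that traces are building and that the join in K of a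
   nested antichain of L avoids B.  The former gives that each building set BL
   of L is the trace of the building set of those z such that, for every l > 0
   with z <= f l, z lies below f b for some b in BL with b <= l. *)
Require Import Defs.
From mathcomp Require Import all_boot all_order.
From mathcomp Require Import boolp.

Import Order.TTheory.
Local Open Scope order_scope.

(** * Decompositions of an element and their closure properties *)

Section Decomposition.
Context {d : Order.disp_t} {P : finBMeetSemilatticeType d}.
Implicit Types (x y z t u v w m : P) (A B M Y : {set P}).

(* Meets, unlike joins, are total: the last two clauses say that
   z |-> (z /\ u)_u reflects the order and is onto the product. *)
Definition decomp x A : Prop :=
  [/\ {in A, forall u, u <= x},
      forall z w, z <= x -> {in A, forall u, z `&` u <= w} -> z <= w
    & forall a : P -> P, {in A, forall u, a u <= u} ->
        exists2 j, j <= x & {in A, forall u, j `&` u = a u}].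

Lemma decomp_self x : decomp x [set x].
Proof.
split=> [u /set1P-> //|z w zx /(_ x (set11 x))|a /(_ x (set11 x)) ax].
  by rewrite (meet_idPl zx).
by exists (a x) => // u /set1P->; apply/meet_idPl.
Qed.

Lemma decomp_bot : decomp \bot set0.
Proof.
split=> [u|z w|a _]; rewrite ?inE //; last by exists \bot => // u; rewrite inE.
by rewrite lex0 => /eqP->; rewrite le0x.
Qed.

(** Prescribing [u] at [u] and [\bot] at the other members gives a [j] above [u] that meets [v]
    trivially. *)
Lemma decomp_disjoint x A u v :
  decomp x A -> u \in A -> v \in A -> u != v -> u `&` v = \bot.
Proof.
move=> [_ _ D2] uA vA uv.
have [|j _ jE] := D2 (fun t => if t == u then u else \bot).
  by move=> t _; case: eqP => [->|_] //; rewrite le0x.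
have := jE _ uA; rewrite eqxx => /meet_idPr uj.
have := jE _ vA; rewrite eq_sym (negPf uv) => jv.
by apply/eqP; rewrite -lex0 -jv leI2.
Qed.

Lemma decomp_refine x A (D : P -> {set P}) :
  decomp x A -> {in A, forall u, decomp u (D u)} ->
  decomp x (\bigcup_(u in A) D u).
Proof.
move=> [D0 D1 D2] DD; split.
- move=> v /bigcupP[u uA vu]; have [/(_ v vu) vu' _ _] := DD u uA.
  exact: le_trans vu' (D0 _ uA).
- move=> z w zx zw; apply: D1 => // u uA; have [_ E1 _] := DD u uA.
  apply: E1 => [|v vu]; first exact: leIr.
  apply: le_trans (zw v _); last by apply/bigcupP; exists u.
  by rewrite leI2 ?leIl.
- move=> a aP.
  have /choice[s sP] : forall u, exists j, u \in A ->
      j <= u /\ {in D u, forall v, j `&` v = a v}.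
    move=> u; have [uA|_] := boolP (u \in A); last by exists \bot.
    have [_ _ E2] := DD u uA; case: (E2 a) => [v vu|j ju jE].
      by apply: aP; apply/bigcupP; exists u.
    by exists j.
  have [u uA|j jx jE] := D2 s; first by case: (sP u uA).
  exists j => // v /bigcupP[u uA vu]; have [su sE] := sP u uA.
  have [E0 _ _] := DD u uA.
  by rewrite -(sE v vu) -(jE u uA) -meetA (meet_idPr (E0 v vu)).
Qed.

(** Each [m] in [M] lies below one [y] and meets the others in [\bot], so [Y] cuts [M] into groups.
    Values prescribed on [Y] transfer to [M] by cutting [a (g m)] down to [m]. *)
Lemma decomp_coarsen x M Y : decomp x M -> {in Y, forall y, y <= x} ->
  {in M, forall m, exists2 y, y \in Y & m <= y /\
     {in Y, forall y', y' != y -> y' `&` m = \bot}} ->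
  decomp x Y.
Proof.
move=> [D0 D1 D2] Yx MY; split=> //.
  move=> z w zx zw; apply: D1 => // m mM; have [y yY [my _]] := MY m mM.
  by apply: le_trans (zw y yY); rewrite leI2.
move=> a aY.
have /choice[g gP] : forall m, exists y, m \in M ->
    [/\ y \in Y, m <= y & {in Y, forall y', y' != y -> y' `&` m = \bot}].
  move=> m; have [mM|_] := boolP (m \in M); last by exists \bot.
  by have [y ? []] := MY m mM; exists y.
have [m mM|j jx jE] := D2 (fun m => a (g m) `&` m); first exact: leIr.
exists j => // y yY; have ay := aY y yY.
have far m : m \in M -> g m != y -> y `&` m = \bot.
  by move=> mM; rewrite eq_sym; have [_ _] := gP m mM; apply.
apply/le_anti/andP; split.
  apply: D1 => [|m mM]; first exact: le_trans (leIl _ _) jx.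
  have [gy|/(far m mM) ym] := eqVneq (g m) y.
    by rewrite meetAC jE // gy leIxl // leIl.
  by rewrite -meetA ym meetx0 le0x.
rewrite lexI ay andbT; apply: D1 => [|m mM].
  exact: le_trans ay (Yx y yY).
have [gy|/(far m mM) ym] := eqVneq (g m) y.
  by have := jE m mM; rewrite gy => <-; rewrite leIl.
by apply: le_trans (le0x j); rewrite -ym leI2.
Qed.

(** Distinct members of [A] may have the same meet with [z]. This is harmless, as a family on the
    meets is pulled back along u |-> z /\ u. *)
Lemma decomp_restrict x z A :
  decomp x A -> z <= x -> decomp z [set z `&` u | u in A].
Proof.
move=> [_ D1 D2] zx; split.
- by move=> _ /imsetP[u _ ->]; rewrite leIl.
- move=> y w yz yw; apply: D1 => [|u uA]; first exact: le_trans yz zx.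
  by rewrite -(meet_idPl yz) -meetA; apply: yw; apply: imset_f.
- move=> a aP.
  have aP' u : u \in A -> a (z `&` u) <= z `&` u.
    by move=> uA; apply: aP; apply: imset_f.
  have [u uA|j jx jE] := D2 (fun u => a (z `&` u)).
    exact: le_trans (aP' u uA) (leIr _ _).
  exists j; first by apply: D1 => // u uA; rewrite jE // (le_trans (aP' u uA)) ?leIl.
  move=> _ /imsetP[u uA ->].
  by rewrite meetCA jE // (meet_idPr (le_trans (aP' u uA) (leIl _ _))).
Qed.

(** * Maximal elements below a bound, and joins of bounded sets *)

Lemma belowP B x z : reflect (z \in B /\ z <= x) (z \in below B x).
Proof. by rewrite inE; apply: andP. Qed.

Lemma max_belowP B x z :
  reflect ([/\ z \in B, z <= x
             & forall w, w \in B -> w <= x -> z <= w -> w = z])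
          (z \in max_below B x).
Proof.
rewrite inE; apply: (iffP andP) => [[/belowP[zB zx] /forall_inP zm]|[zB zx zm]].
  by split=> // w wB wx zw; apply/eqP/(implyP (zm w _)) => //; apply/belowP.
split; first exact/belowP.
by apply/forall_inP => w /belowP[wB wx]; apply/implyP => zw; apply/eqP/zm.
Qed.

(** The size of the principal down-set serves as a rank, for extremal choices and for induction. *)
Lemma card_le_lt u x : u < x -> (#|[set z | (z <= u)%O]| < #|[set z | (z <= x)%O]|)%N.
Proof.
move=> ux; apply/proper_card/properP; split.
  by apply/subsetP => z; rewrite !inE => /le_trans; apply; apply: ltW.
by exists x; rewrite !inE // lt_geF.
Qed.

Lemma max_below_exists B x b :
  b \in B -> b <= x -> exists2 m, m \in max_below B x & b <= m.
Proof.
move=> bB bx; pose p z := [&& z \in B, z <= x & b <= z].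
have pb : p b by rewrite /p bB bx lexx.
case: (arg_maxnP (fun z => #|[set t | t <= z]|) pb) => m /and3P[mB mx bm] mm.
exists m => //; apply/max_belowP; split=> // w wB wx mw.
apply/eqP; apply: contraT => wm; have /card_le_lt : m < w by rewrite lt_neqAle eq_sym wm.
by rewrite ltnNge => /negP[]; apply: mm; rewrite /p wB wx (le_trans bm).
Qed.

(** Upper bounds are closed under binary meets, so one whose down-set has least size is the least of
    them. *)
Lemma is_join_exists A u :
  {in A, forall a, a <= u} -> exists2 w, is_join A w & w <= u.
Proof.
move=> Au; pose p z := [forall a in A, a <= z].
have pu : p u by apply/forall_inP.
case: (arg_minnP (fun z => #|[set t | t <= z]|) pu) => w /forall_inP Aw wm.
have wmin v : {in A, forall a, a <= v} -> w <= v.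
  move=> Av; apply/meet_idPl/eqP; apply: contraT => wv.
  have /card_le_lt : w `&` v < w by rewrite lt_neqAle wv leIl.
  rewrite ltnNge => /negP[]; apply: wm; apply/forall_inP => a aA.
  by rewrite lexI Aw ?Av.
by exists w; [split|apply: wmin].
Qed.

(** * Decompositions as product isomorphisms *)

Lemma itv_val_le x y : {mono (val : poset_itv x y -> P) : s t / s <= t}.
Proof. exact: Order.le_val. Qed.

Lemma itv_le x (t : poset_itv \bot x) : val t <= x.
Proof. by case: t => t /= /andP[]. Qed.

Definition itv_mk x t (tx : t <= x) : poset_itv \bot x :=
  PosetItv (introT andP (conj (le0x t) tx)).

(** The join map is inverse to z |-> (z /\ b)_b. In one direction, the second clause of [decomp]
    shows that the element with coordinates [y] is their join; in the other, the coordinates of a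
    join are recovered because [phi] reflects the order. *)
Lemma decomp_isoP x A : {in A, forall u, u <= x} ->
  decomp x A <->
  exists phi : itv_prod A -> poset_itv \bot x,
    is_join_map phi /\ order_iso (@itv_prod_le _ _ A) <=%O phi.
Proof.
move=> Ax.
split=> [[_ D1 D2]|[phi [phiJ [[psi phiK psiK] phiM]]]].
  have /choice[phi phiP] : forall y : itv_prod A, exists j : poset_itv \bot x,
      forall b : {b | b \in A}, val j `&` val b = val (y b).
    move=> y; pose a u := if insub u is Some b then val (y b) else \bot.
    have aE (b : {b | b \in A}) : a (val b) = val (y b) by rewrite /a valK.
    have [u uA|j jx jE] := D2 a; first by rewrite (aE (Sub u uA)) itv_le.
    by exists (itv_mk x j jx) => b; rewrite jE ?aE //; apply: valP.
  have le_phi (y : itv_prod A) w :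
      (forall b, val (y b) <= w) -> val (phi y) <= w.
    move=> yw; apply: D1 => [|u uA]; first exact: itv_le.
    by rewrite (phiP y (Sub u uA)).
  have phi_ge (y : itv_prod A) b : val (y b) <= val (phi y).
    by rewrite -phiP leIl.
  exists phi; split=> [y|].
    split=> [_ /imsetP[b _ ->]|w yw]; first exact: phi_ge.
    by apply: le_phi => b; apply: yw; apply: imset_f.
  split; last first.
    move=> y y'; apply/idP/forallP => [yy' b|yy'].
      by rewrite -itv_val_le /= -!phiP leI2 // itv_val_le.
    rewrite -itv_val_le; apply: le_phi => b; apply: le_trans (phi_ge y' b).
    by rewrite itv_val_le.
  pose psi (z : poset_itv \bot x) : itv_prod A :=
    [ffun b : {b | b \in A} => itv_mk (val b) (val z `&` val b) (leIr _ _)].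
  exists psi => [y|z].
    by apply/ffunP => b; apply: val_inj; rewrite ffunE /= phiP.
  apply/val_inj/le_anti/andP; split.
    by apply: le_phi => b; rewrite ffunE /= leIl.
  apply: D1 => [|u uA]; first exact: itv_le.
  by have := phi_ge (psi z) (Sub u uA); rewrite ffunE.
split=> // [z w zx zw|a aA].
  pose y := psi (itv_mk x z zx); have [yub ymin] := phiJ y.
  rewrite psiK /= in yub ymin; apply: ymin => _ /imsetP[b _ ->].
  apply: le_trans (zw (val b) (valP b)).
  by rewrite lexI itv_le yub //; apply/imsetP; exists b.
pose y : itv_prod A :=
  [ffun b : {b | b \in A} => itv_mk (val b) (a (val b)) (aA _ (valP b))].
have [yub _] := phiJ y; exists (val (phi y)) => [|u uA]; first exact: itv_le.
pose b0 : {b | b \in A} := Sub u uA.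
set c := val (phi y) `&` u; apply/le_anti/andP; split; last first.
  by rewrite lexI aA // andbT; apply: yub; apply/imsetP; exists b0; rewrite ?ffunE.
have cu : c <= u := leIr _ _.
(* The family [y'] is [c] at [b0] and [\bot] elsewhere. Its join is below [phi y], and reflecting
   this inequality at [b0] bounds [c] by [a u]. *)
pose y' : itv_prod A := [ffun b : {b | b \in A} =>
  itv_mk (val b) (if b == b0 then c `&` val b else \bot)
    (ltac:(by case: ifP => _; rewrite ?leIr ?le0x))].
have [_ y'min] := phiJ y'.
have : phi y' <= phi y.
  rewrite -itv_val_le; apply: y'min => _ /imsetP[b _ ->]; rewrite ffunE /=.
  by case: ifP; rewrite ?le0x // => _; rewrite leIxl // leIl.
rewrite phiM => /forallP/(_ b0); rewrite -itv_val_le !ffunE /= eqxx.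
by rewrite (meet_idPl cu).
Qed.

(** * Building sets and irreducible elements *)

Lemma building_setP B : building_set B <->
  B \subset pos_elts P /\ forall x, x \in pos_elts P -> decomp x (max_below B x).
Proof.
have mb x : {in max_below B x, forall u, u <= x} by move=> u /max_belowP[].
split=> -[BP H]; split=> // x /H; first by move/decomp_isoP; apply.
by move/(decomp_isoP _ _ (mb x)).
Qed.

Lemma posP x : reflect (x <> \bot) (x \in pos_elts P).
Proof. by rewrite inE; apply: (iffP idP) => /eqP. Qed.

(** Induction on the size of the down-set of [x]. For [x] outside [B], the elements of [B] below [x]
    are distributed among the members of [A], so [max_below B x] is the union of the [max_below B u]
    and [decomp_refine] applies. *)
Lemma building_criterion B : B \subset pos_elts P ->
  (forall x, x != \bot -> x \notin B -> exists A,
     [/\ decomp x A, x \notin A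
       & forall b, b \in B -> b <= x -> exists2 u, u \in A & b <= u]) ->
  forall x, decomp x (max_below B x).
Proof.
move=> /subsetP BP H x.
have [n] := ubnP #|[set z | z <= x]|; elim: n x => // n IH x xn.
have [->|x0] := eqVneq x \bot.
  suff -> : max_below B \bot = set0 by exact: decomp_bot.
  apply/setP => b; rewrite in_set0; apply/negbTE/negP => /max_belowP[/BP/posP bB + _].
  by rewrite lex0 => /eqP.
have [xB|xB] := boolP (x \in B).
  suff -> : max_below B x = [set x] by exact: decomp_self.
  apply/setP => b; rewrite inE; apply/max_belowP/eqP => [[_ bx /(_ x xB)]|->].
    by rewrite lexx => ->.
  by split=> // w _ wx xw; apply/le_anti/andP.
have [A [Ax xA cov]] := H x x0 xB.
have [A0 _ _] := Ax.
suff -> : max_below B x = \bigcup_(u in A) max_below B u.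
  apply: decomp_refine => // u uA; apply: IH.
  rewrite -ltnS; apply: leq_trans xn; rewrite ltnS; apply: card_le_lt.
  by rewrite lt_neqAle A0 // andbT; apply: contraNneq xA => <-.
apply/setP => b; apply/max_belowP/bigcupP => [[bB bx bm]|[u uA]].
  have [u uA bu] := cov b bB bx; exists u => //; apply/max_belowP; split=> // w wB wu.
  by apply: bm => //; apply: le_trans wu (A0 u uA).
move=> /max_belowP[bB bu bm]; split=> //; first exact: le_trans bu (A0 u uA).
move=> w wB wx bw; have [v vA wv] := cov w wB wx.
have [uv|uv] := eqVneq u v; first by apply: bm; rewrite // uv.
(* If [w] were below another member [v], then [b] would lie below the trivial meet of [u] and
   [v]. *)
have /posP[] := BP b bB; apply/eqP.
by rewrite -lex0 -(decomp_disjoint _ _ _ _ Ax uA vA uv) lexI bu (le_trans bw).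
Qed.

(** Otherwise a nonzero [u] in [A] and the join [v] of the remaining members form a two-element
    decomposition, which makes the interval below [m] a product. *)
Lemma irreducible_decomp m A : m \in irreducibles P -> decomp m A -> m \in A.
Proof.
rewrite !inE => /andP[m0 /asboolP mI] mA; apply: contrapT => mnA; apply: mI.
have [D0 D1 D2] := mA.
have [u uA u0] : exists2 u, u \in A & u != \bot.
  apply: contrapT => An; move/negP: m0; apply; rewrite -lex0.
  apply: D1 => // u uA; have [->|u0] := eqVneq u \bot; first exact: leIr.
  by case: An; exists u.
have [|v vm vE] := D2 (fun t => if t == u then \bot else t).
  by move=> t _; case: ifP; rewrite ?le0x.
have uv : u `&` v = \bot by have := vE u uA; rewrite eqxx meetC.
(* If [v] vanished, so would all members other than [u], and [m] would equal [u]. *)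
have v0 : v != \bot.
  apply/eqP => vb; apply: mnA; rewrite (_ : m = u) //.
  apply/le_anti; rewrite D0 // andbT; apply: D1 => // t tA.
  have := vE t tA; rewrite vb meet0x; have [-> _|_ <-] := eqVneq t u.
    exact: leIr.
  by rewrite meetx0 le0x.
have vu : v != u by apply: contraNneq v0 => vu; rewrite -uv vu meetxx.
have [_ C1 C2] : decomp m [set u; v].
  apply: (decomp_coarsen _ _ _ mA).
    by move=> t /set2P[]-> //; apply: D0.
  move=> t tA; have [->|tu] := eqVneq t u.
    exists u; first exact: set21.
    by split=> // _ /set2P[]->; rewrite ?eqxx // meetC uv.
  exists v; first exact: set22.
  have := vE t tA; rewrite (negPf tu) => /meet_idPr tv; split=> //.
  move=> _ /set2P[]->; rewrite ?eqxx // => _.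
  by apply: (decomp_disjoint _ _ _ _ mA); rewrite // eq_sym.
have card_itv w : w != \bot -> (1 < #|{: poset_itv \bot w}|)%N.
  move=> w0; apply/card_gt1P; exists (itv_mk w \bot (le0x w)), (itv_mk w w (lexx w)).
  by split=> //; apply: contraNneq w0 => /(congr1 val) /= <-.
pose F (z : poset_itv \bot m) : poset_itv \bot u *p poset_itv \bot v :=
  (itv_mk u (val z `&` u) (leIr _ _), itv_mk v (val z `&` v) (leIr _ _)).
have FM : {mono F : x y / x <= y}.
  move=> x y; rewrite Order.ProdOrder.leEprod -!itv_val_le /=; apply/andP/idP => [[xu xv]|xy].
    apply: C1 => [|_ /set2P[]->]; first exact: itv_le.
      by apply: le_trans xu _; rewrite leIl.
    by apply: le_trans xv _; rewrite leIl.
  by rewrite !leI2.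
exists d, d, (poset_itv \bot u), (poset_itv \bot v), F.
split; rewrite ?card_itv //; split=> //.
have /choice[G GP] : forall q : poset_itv \bot u *p poset_itv \bot v,
    exists z : poset_itv \bot m, F z = q.
  move=> [p q]; have [|j jm jE] := C2 (fun t => if t == u then val p else val q).
    by move=> _ /set2P[]->; rewrite ?eqxx ?(negPf vu) itv_le.
  exists (itv_mk m j jm); rewrite /F /=; congr pair; apply: val_inj => /=.
    by rewrite jE ?set21 // eqxx.
  by rewrite jE ?set22 // (negPf vu).
by exists G => // z; apply: (inc_inj FM); rewrite GP.
Qed.

(** The two members have coordinates (top, bottom) and (bottom, top) in a factorisation of the
    interval below [m]. Neither is [m], since both factors have at least two elements. *)
Lemma reducible_decomp m : m != \bot -> m \notin irreducibles P ->
  exists A, decomp m A /\ m \notin A.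
Proof.
rewrite !inE => m0; rewrite m0 => /asboolPn/contrapT.
move=> [d1 [d2 [Q1 [Q2 [F [c1 c2 [[G FK GK] FM]]]]]]].
pose bt := itv_mk m \bot (le0x m); pose tp := itv_mk m m (lexx m).
have GM : {mono G : x y / x <= y} by move=> x y; rewrite -FM !GK.
have btP q : F bt <= q by rewrite -GM FK -itv_val_le le0x.
have tpP q : q <= F tp by rewrite -GM FK -itv_val_le itv_le.
have b1 q : (F bt).1 <= q.
  by have := btP (q, (F bt).2); rewrite Order.ProdOrder.leEprod => /andP[].
have b2 q : (F bt).2 <= q.
  by have := btP ((F bt).1, q); rewrite Order.ProdOrder.leEprod => /andP[].
have t1 q : q <= (F tp).1.
  by have := tpP (q, (F bt).2); rewrite Order.ProdOrder.leEprod => /andP[].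
have t2 q : q <= (F tp).2.
  by have := tpP ((F bt).1, q); rewrite Order.ProdOrder.leEprod => /andP[].
pose U := G ((F tp).1, (F bt).2); pose V := G ((F bt).1, (F tp).2).
have leF (s t : poset_itv \bot m) :
    (val s <= val t) = ((F s).1 <= (F t).1) && ((F s).2 <= (F t).2).
  by rewrite itv_val_le -FM Order.ProdOrder.leEprod.
have FU : F U = ((F tp).1, (F bt).2) by rewrite GK.
have FV : F V = ((F bt).1, (F tp).2) by rewrite GK.
exists [set val U; val V]; split; last first.
  apply/negP => /set2P[] mE.
    have : val tp <= val U by rewrite -mE.
    rewrite leF FU /= => /andP[_ tb].
    have /card_gt1P[p [q [_ _ /eqP[]]]] := c2.
    by apply: le_anti; rewrite !(le_trans (t2 _) (le_trans tb (b2 _))).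
  have : val tp <= val V by rewrite -mE.
  rewrite leF FV /= => /andP[tb _].
  have /card_gt1P[p [q [_ _ /eqP[]]]] := c1.
  by apply: le_anti; rewrite !(le_trans (t1 _) (le_trans tb (b1 _))).
split.
- by move=> _ /set2P[]->; apply: itv_le.
(* As [w] need not lie below [m], its meet with [m] replaces it; [S] and [T] are the projections of
   [Z] to the two axes. *)
- move=> z w zm zw; pose Z := itv_mk m z zm; pose W := itv_mk m (w `&` m) (leIr _ _).
  suff : val Z <= val W by rewrite lexI => /andP[].
  pose S := G ((F Z).1, (F bt).2); pose T := G ((F bt).1, (F Z).2).
  have SW : val S <= val W.
    rewrite lexI itv_le andbT; apply: le_trans (zw (val U) (set21 _ _)).
    by rewrite lexI -[z]/(val Z) !leF FU !GK /= lexx b2 t1 lexx.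
  have TW : val T <= val W.
    rewrite lexI itv_le andbT; apply: le_trans (zw (val V) (set22 _ _)).
    by rewrite lexI -[z]/(val Z) !leF FV !GK /= lexx b1 t2 lexx.
  move: SW TW; rewrite !leF !GK /= => /andP[-> _] /andP[_ ->] //.
- move=> a aP; have aU := aP _ (set21 _ _); have aV := aP _ (set22 _ _).
  pose S := itv_mk m (a (val U)) (le_trans aU (itv_le _ _)).
  pose T := itv_mk m (a (val V)) (le_trans aV (itv_le _ _)).
  pose J := G ((F S).1, (F T).2); exists (val J); first exact: itv_le.
  have /andP[_ SU] : ((F S).1 <= (F U).1) && ((F S).2 <= (F U).2) by rewrite -leF.
  have /andP[TV _] : ((F T).1 <= (F V).1) && ((F T).2 <= (F V).2) by rewrite -leF.
  rewrite FU /= in SU; rewrite FV /= in TV.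
  move=> _ /set2P[]->; apply/le_anti/andP; split.
  + pose X := itv_mk m (val J `&` val U) (le_trans (leIl _ _) (itv_le _ _)).
    have : val X <= val J by exact: leIl.
    have : val X <= val U by exact: leIr.
    rewrite -[a _]/(val S) -[_ `&` _]/(val X) !leF FU GK /=.
    by move=> /andP[_ Xb] /andP[-> _]; rewrite (le_trans Xb).
  + rewrite lexI aU andbT -[a _]/(val S) leF GK /= lexx /=.
    exact: le_trans SU (b2 _).
  + pose X := itv_mk m (val J `&` val V) (le_trans (leIl _ _) (itv_le _ _)).
    have : val X <= val J by exact: leIl.
    have : val X <= val V by exact: leIr.
    rewrite -[a _]/(val T) -[_ `&` _]/(val X) !leF FV GK /=.
    by move=> /andP[Xb _] /andP[_ ->]; rewrite (le_trans Xb).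
  + rewrite lexI aV andbT -[a _]/(val T) leF GK /= lexx andbT.
    exact: le_trans TV (b1 _).
Qed.

(** By irreducibility, restricting the decomposition to [m] leaves [m] itself among the members. *)
Lemma irreducible_prime m x A : m \in irreducibles P -> decomp x A -> m <= x ->
  exists2 u, u \in A & m <= u.
Proof.
move=> mI xA mx; have /imsetP[u uA mE] :=
  irreducible_decomp _ _ mI (decomp_restrict _ _ _ xA mx).
by exists u => //; apply/meet_idPl.
Qed.

Lemma irreducibles_pos : irreducibles P \subset pos_elts P.
Proof. by apply/subsetP => x; rewrite inE => /andP[]. Qed.

(** The irreducibles satisfy the criterion: reducible elements split, and irreducibles are prime for
    every splitting. *)
Lemma decomp_irreducibles x : decomp x (max_below (irreducibles P) x).
Proof.
apply: building_criterion; first exact: irreducibles_pos.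
move=> {}x x0 /(reducible_decomp _ x0)[A [xA xnA]]; exists A; split=> // b bI.
exact: irreducible_prime.
Qed.

Lemma le_irreducibles x w :
  {in irreducibles P, forall m, m <= x -> m <= w} -> x <= w.
Proof.
move=> H; have [_ D1 _] := decomp_irreducibles x.
apply: D1 => // u /max_belowP[uI ux _]; exact: le_trans (leIr _ _) (H u uI ux).
Qed.

Lemma irreducibles_sub_building B : building_set B -> irreducibles P \subset B.
Proof.
move=> /building_setP[_ H]; apply/subsetP => m mI.
have /H/(irreducible_decomp _ _ mI)/max_belowP[//] := subsetP irreducibles_pos m mI.
Qed.

End Decomposition.

(** * Decompositions under a consistent embedding *)

Section Embedding.
Context {dL dK : Order.disp_t}.
Context {L : finBMeetSemilatticeType dL} {K : finBMeetSemilatticeType dK}.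
Variable f : L -> K.
Hypotheses (f_emb : meet_embedding f) (f_cons : consistent f).

Let f_mono : {mono f : x y / x <= y} := f_emb.1.
Let f_meet : {morph f : x y / x `&` y} := f_emb.2.
Let f_inj : injective f := inc_inj f_mono.

Lemma consistentP (l : L) (k : K) : l != \bot -> k \in irreducibles K ->
  k <= f l -> exists m, [/\ k = f m, m \in irreducibles L & m <= l].
Proof.
move=> l0 kI kl.
have lP : l \in pos_elts L by rewrite inE.
have kB : k \in below (irreducibles K) (f l) by apply/belowP.
have /imsetP[m /belowP[mI ml] kE] := subsetP (f_cons l lP) k kB.
by exists m.
Qed.

(** An irreducible of [K] below [f \bot] would come from an irreducible of [L] below [\bot]. A
    nonzero [l] is required because consistency is vacuous on a one-point [L]. *)
Lemma embedding_bot (l : L) : l != \bot -> f \bot = \bot.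
Proof.
move=> l0; apply/eqP; rewrite -lex0; apply: le_irreducibles => k kI kb.
have [|m [kE mI _]] := consistentP l k l0 kI; first by rewrite (le_trans kb) ?f_mono ?le0x.
have /posP[] := subsetP irreducibles_pos m mI.
by apply/eqP; rewrite -lex0 -f_mono -kE.
Qed.

(** Coarsen the decomposition of [f l] into irreducibles of [K]: these come from irreducibles of [L]
    below [l], each of which lies below a member of [A]. *)
Lemma decomp_image (l : L) (A : {set L}) : l != \bot ->
  decomp l A -> decomp (f l) (f @: A).
Proof.
move=> l0 lA; have [A0 _ _] := lA.
apply: (decomp_coarsen _ (max_below (irreducibles K) (f l))).
- exact: decomp_irreducibles.
- by move=> _ /imsetP[u uA ->]; rewrite f_mono A0.
move=> k /max_belowP[kI kl _].
have [m [-> mI ml]] := consistentP l k l0 kI kl.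
have [u uA mu] := irreducible_prime _ _ _ mI lA ml.
exists (f u); first exact: imset_f.
split; first by rewrite f_mono.
move=> _ /imsetP[v vA ->]; rewrite (inj_eq f_inj) => vu.
rewrite -f_meet -[RHS](embedding_bot l l0); congr f; apply/eqP.
by rewrite -lex0 -(decomp_disjoint _ _ _ _ lA vA uA vu) leI2.
Qed.

(** * Extending a building set from [L] to [K] *)

Definition extension (BL : {set L}) : {set K} :=
  [set z in pos_elts K | [forall l in pos_elts L, (z <= f l) ==>
     [exists b in BL, (b <= l) && (z <= f b)]]].

Lemma extensionP (BL : {set L}) z :
  reflect (z != \bot /\ forall l, l != \bot -> z <= f l ->
             exists2 b, b \in below BL l & z <= f b)
          (z \in extension BL).
Proof.
rewrite !inE; apply: (iffP andP) => -[z0 H]; split=> //.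
  move=> l l0 zl; have lP : l \in pos_elts L by rewrite inE.
  have /exists_inP[b bB /andP[bl zb]] := implyP (forall_inP H l lP) zl.
  by exists b => //; apply/belowP.
apply/forall_inP => l; rewrite inE => l0; apply/implyP => zl.
have [b /belowP[bB bl] zb] := H l l0 zl.
by apply/exists_inP; exists b; rewrite ?bl.
Qed.

(** A nonzero [z] below no [f l] with [l] nonzero belongs vacuously. If [z] fails the condition at
    [l], decompose [l] by the maximal elements of [BL], transport to [f l] and cut down to [z]; no
    member is [z], since [z] is below none of these [f b]. *)
Lemma extension_building (BL : {set L}) :
  building_set BL -> building_set (extension BL).
Proof.
move=> /building_setP[BP H].
have EP : extension BL \subset pos_elts K by apply/subsetP => z; rewrite inE => /andP[].
apply/building_setP; split=> // z _; apply: building_criterion => // {}z z0 zE.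
have [l [l0 zl lB]] : exists l,
    [/\ l != \bot, z <= f l & forall b, b \in below BL l -> ~~ (z <= f b)].
  apply: contrapT => Hl; move/negP: zE; apply; apply/extensionP; split=> // l l0 zl.
  apply: contrapT => Hb; apply: Hl; exists l; split=> // b bl; apply/negP => zb.
  by apply: Hb; exists b.
have lD : decomp l (max_below BL l) by apply: H; rewrite inE.
exists [set z `&` u | u in f @: max_below BL l]; split.
- exact: decomp_restrict (decomp_image _ _ l0 lD) zl.
- apply/imsetP => -[_ /imsetP[b /max_belowP[bB bl _] ->] zE'].
  have bB' : b \in below BL l by apply/belowP.
  by have /negP[] := lB b bB'; apply/meet_idPl.
- move=> k /extensionP[_ /(_ l l0) kE] kz.
  have [b /belowP[bB bl] kb] := kE (le_trans kz zl).
  have [m mB bm] := max_below_exists _ _ _ bB bl.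
  exists (z `&` f m); first by do 2!apply: imset_f.
  by rewrite lexI kz (le_trans kb) // f_mono.
Qed.

(** * Traces, and decompositions pulled back to [L] *)

Lemma traceP (B : {set K}) l :
  reflect (l != \bot /\ f l \in B) (l \in trace f B).
Proof. by rewrite !inE; apply: andP. Qed.

(** Testing the condition for [f l] at [l] itself gives a [b] in [BL] that must equal [l]. *)
Lemma trace_extension (BL : {set L}) :
  building_set BL -> trace f (extension BL) = BL.
Proof.
move=> [/subsetP BP _]; apply/setP => l; apply/traceP/idP => [[l0]|lB].
  move=> /extensionP[_ /(_ l l0 (lexx _))[b /belowP[bB bl]]].
  by rewrite f_mono => lb; rewrite (le_anti (_ : l <= b <= l)) ?lb.
have := BP l lB; rewrite inE => l0; split=> //; apply/extensionP; split.
  by rewrite -(embedding_bot l l0) (inj_eq f_inj).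
by move=> l' _; rewrite f_mono => ll'; exists l => //; apply/belowP.
Qed.

(** The irreducible factors of [l] are grouped by the factor of [f l] above their image, and each
    group is joined. The last clause allows [k] outside the image of [f], because a join in [K] of
    images may leave the image. *)
Lemma decomp_pullback (B : {set K}) (l : L) :
  building_set B -> f @: irreducibles L \subset B -> l != \bot -> f l \notin B ->
  exists A : {set L}, [/\ decomp l A, l \notin A
    & forall k, k \in B -> k <= f l ->
        exists2 u, u \in A & forall b, b <= l -> f b <= k -> b <= u].
Proof.
move=> /building_setP[_ HB] /subsetP IB l0 flB.
have fbot := embedding_bot l l0.
have fD : decomp (f l) (max_below B (f l)).
  by apply: HB; rewrite inE -fbot (inj_eq f_inj).
have lM := decomp_irreducibles l; set M := max_below (irreducibles L) l in lM.
(* [g m] is a factor of [f l] above [f m]; it exists because [f m] is in [B]. *)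
have /choice[g gP] : forall m, exists k, m \in M -> k \in max_below B (f l) /\ f m <= k.
  move=> m; have [/max_belowP[mI ml _]|_] := boolP (m \in M); last by exists \bot.
  have [||k kB itv_mk] := max_below_exists B (f l) (f m); rewrite ?f_mono ?IB ?imset_f //.
  by exists k.
have sep k m b : m \in M -> k \in max_below B (f l) -> k != g m -> f b <= k ->
    b `&` m = \bot.
  move=> mM kB kg bk; have [gB mg] := gP m mM; apply: f_inj; apply/eqP.
  rewrite f_meet fbot -lex0 -(decomp_disjoint _ _ _ _ fD kB gB kg).
  exact: leI2.
have [_ D1 D2] := lM.
(* [y k] is the join of the group of [k], given by its coordinates; it is [\bot] when the group is
   empty. *)
have /choice[y yP] : forall k, exists y, y <= l /\
    {in M, forall m, y `&` m = if g m == k then m else \bot}.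
  move=> k; case: (D2 (fun m => if g m == k then m else \bot)) => [m mM|y]; last by exists y.
  by case: ifP => // _; rewrite le0x.
exists (y @: max_below B (f l)); split.
- apply: (decomp_coarsen _ _ _ lM); first by move=> _ /imsetP[k _ ->]; case: (yP k).
  move=> m mM; have [gB mg] := gP m mM; exists (y (g m)); first exact: imset_f.
  have [_ yE] := yP (g m); split; first by apply/meet_idPr; rewrite yE ?eqxx.
  move=> _ /imsetP[k _ ->] yk; have [_ ->] := yP k; rewrite // ifN //.
  by apply: contraNneq yk => ->.
- apply/imsetP => -[k /max_belowP[kB kl _] lE].
  have [_ yE] := yP k.
  (* If [y k] is [l], all factors of [l] are in the group of [k], so [f l] is below [k], hence equal
     to it and in [B]. *)
  suff flk : f l <= k by move: flB; rewrite (le_anti (_ : f l <= k <= f l)) ?flk ?kl ?kB.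
  apply: le_irreducibles => k' k'I /(consistentP _ _ l0 k'I)[m0 [-> m0I m0l]].
  have [m mM m0m] := max_below_exists _ _ _ m0I m0l.
  have := yE m mM; rewrite -lE; have [gm _|_] := eqVneq (g m) k.
    by have [_] := gP m mM; rewrite gm; apply: le_trans; rewrite f_mono.
  have /max_belowP[_ ml _] := mM.
  rewrite (meet_idPr ml) => m_bot; have /posP[] := subsetP irreducibles_pos _ m0I.
  by apply/eqP; rewrite -lex0 -m_bot.
- move=> k kB kl; have [x xB kx] := max_below_exists _ _ _ kB kl.
  exists (y x); first exact: imset_f.
  (* A factor [m] outside the group of [x] meets [b] trivially, since [f b] is below [x]; hence [b]
     is below [y x]. *)
  move=> b bl bk; apply: D1 => // m mM; have [_ yE] := yP x.
  have [gx|gx] := eqVneq (g m) x.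
    by apply: le_trans (leIr _ _) _; apply/meet_idPr; rewrite yE // gx eqxx.
  by rewrite (sep x) ?le0x 1?eq_sym // (le_trans bk).
Qed.

Lemma trace_building (B : {set K}) :
  building_set B -> f @: irreducibles L \subset B -> building_set (trace f B).
Proof.
move=> BB IB.
have TP : trace f B \subset pos_elts L by apply/subsetP => l; rewrite inE => /andP[].
apply/building_setP; split=> // l _; apply: building_criterion => // {}l l0 lB.
have [|A [lA lnA H]] := decomp_pullback _ _ BB IB l0.
  by apply: contra lB => lB; apply/traceP.
exists A; split=> // b /traceP[_ fb] bl.
have [|u uA] := H _ fb; first by rewrite f_mono.
by move=> /(_ b bl (lexx _)); exists u.
Qed.

(** Let [z] be the join in [L] of the preimage [A'] of an antichain [A]. The join [w] of [A] in [K]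
    is below [f z]. Were [w] in [B], some member [u] of the pulled-back decomposition of [z] would
    be above all of [A'], hence equal to [z], which is excluded. *)
Lemma nested_image (B : {set K}) (N : {set L}) :
  building_set B -> f @: irreducibles L \subset B ->
  nested_set (trace f B) N -> nested_set B (f @: N).
Proof.
move=> BB IB [/subsetP NB NN]; split.
  by apply/subsetP => _ /imsetP[l /NB/traceP[_ ?] ->].
move=> A AN A2 Aac.
pose A' := f @^-1: A.
have AE : A = f @: A'.
  apply/setP => k; apply/idP/imsetP => [kA|[l + ->]]; last by rewrite inE.
  by have /imsetP[l _ kE] := subsetP AN k kA; exists l; rewrite // inE -kE.
have A'N : A' \subset N.
  apply/subsetP => l; rewrite inE => /(subsetP AN)/imsetP[l' l'N /f_inj->] //.
have A'2 : (2 <= #|A'|)%N by rewrite -(card_imset _ f_inj) -AE.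
have [|z [zub zmin] zB] := NN A' A'N A'2.
  move=> a b; rewrite !inE => aA bA ab.
  have := Aac _ _ aA bA; rewrite (inj_eq f_inj) => /(_ ab).
  by rewrite /Order.comparable !f_mono.
have [a aA'] : exists a, a \in A' by apply/set0Pn; rewrite -card_gt0 ltnW.
have z0 : z != \bot.
  have /traceP[a0 _] := NB a (subsetP A'N a aA').
  by apply: contraNneq a0 => zb; rewrite -lex0 -zb zub.
have [|w wJ wz] := is_join_exists A (f z).
  by rewrite AE => _ /imsetP[b bA' ->]; rewrite f_mono zub.
exists w => //; apply/negP => wB.
have [|D [zD zD' H]] := decomp_pullback _ _ BB IB z0.
  by apply: contra zB => zB; apply/traceP.
have [u uD Hu] := H w wB wz.
have [D0 _ _] := zD.
have zu : z <= u.
  apply: zmin => b bA'; apply: Hu; first exact: zub.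
  by case: wJ => wub _; apply: wub; rewrite inE in bA'.
by move: zD'; rewrite (le_anti (_ : z <= u <= z)) ?zu ?D0 ?uD.
Qed.

End Embedding.

Theorem theorem4p5 (dL dK : Order.disp_t)
    (L : finBMeetSemilatticeType dL) (K : finBMeetSemilatticeType dK)
    (f : L -> K) (f_emb : meet_embedding f) (f_cons : consistent f) :
  building_sets L
    = [set trace f B | B in building_sets K & f @: irreducibles L \subset B]
  /\
  (forall B : {set K},
     B \in building_sets K -> f @: irreducibles L \subset B ->
     [set f @: N | N : {set L} in nested_complex (trace f B)]
       \subset nested_complex B).
Proof.
split; last first.
  move=> B; rewrite inE => /asboolP BB IB; apply/subsetP => _ /imsetP[N + ->].
  by rewrite !inE => /asboolP NN; apply/asboolP; apply: nested_image.
apply/setP => BL; apply/idP/imsetP => [|[B + ->]]; last first.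
  by rewrite !inE => /andP[/asboolP BB IB]; apply/asboolP; apply: trace_building.
rewrite inE => /asboolP BB.
exists (extension f BL); last by rewrite trace_extension.
rewrite !inE; apply/andP; split; first by apply/asboolP; apply: extension_building.
apply/subsetP => _ /imsetP[m mI ->].
have : m \in BL by apply: subsetP mI; apply: irreducibles_sub_building.
by rewrite -{1}(trace_extension f f_emb f_cons _ BB) => /traceP[].
Qed.
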